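(* Let $k$ and $\ell$ be positive even integers with $k\le \ell$ and $m=k+\ell\ge 6$. Then for all nonnegative integers $u,v$ with $u+v=k-1$, $$\mathrm{j}_{m/2}\binom{m/2-1}{u}\binom{m/2-1}{v}\left(\frac{B_m}{m}\left(\frac{B_\ell}{\ell}+\frac{B_k}{k}\right)-\frac{B_\ell}{\ell}\frac{B_k}{k}\right)+\frac{\delta_{k,2}}{2}\in\mathbb{Z}.$$
   Context: $B_j$ are the Bernoulli numbers ($t/(e^t-1)=\sum_j B_j t^j/j!$). For $N\ge1$, $\mathrm{j}_N$ denotes the positive denominator of $B_{2N}/(2N)$ written in lowest terms. $\delta_{k,2}$ is the Kronecker delta (equal to $1$ if $k=2$, else $0$). *)

(* Defs.v *)
From mathcomp Require Import all_boot all_order all_algebra.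

Set Implicit Arguments.
Unset Strict Implicit.
Unset Printing Implicit Defensive.

Import Order.TTheory GRing.Theory Num.Theory.

Local Open Scope ring_scope.

(* [:: B_0/0!; ...; B_(n-1)/(n-1)!], the first n coefficients of the formal
   power series t / (e^t - 1), obtained by inverting
   (e^t - 1) / t = \sum_i t^i / (i+1)!.                                       *)
Fixpoint bernoulli_coefs (n : nat) : seq rat :=
  if n is n'.+1 then
    let s := bernoulli_coefs n' in
    rcons s ((n' == 0%N)%:R - \sum_(j < n') s`_j / ((n' - j).+1`!)%:R)
  else [::].

(* The convention is B_1 = -1/2. *)
Definition bernoulli (n : nat) : rat :=
  (n`!)%:R * (bernoulli_coefs n.+1)`_n.

Definition expm1_coef (n : nat) : rat :=
  if n is 0 then 0 else (n`!)%:R^-1.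

(* t = (e^t - 1) * \sum_j B_j t^j / j! as formal power series over rat,
   coefficient by coefficient.                                               *)
Definition bernoulli_egf (B : nat -> rat) : Prop :=
  forall n : nat,
    \sum_(j < n.+1) B j / (j`!)%:R * expm1_coef (n - j) = (n == 1%N)%:R.

Lemma size_bernoulli_coefs n : size (bernoulli_coefs n) = n.
Proof. by elim: n => //= n IHn; rewrite size_rcons IHn. Qed.

Lemma nth_bernoulli_coefs n j :
  (j < n)%N -> (bernoulli_coefs n)`_j = bernoulli j / (j`!)%:R.
Proof.
move=> ltjn; rewrite /bernoulli mulrC mulKf; last by rewrite pnatr_eq0 -lt0n fact_gt0.
elim: n ltjn => // n IHn; rewrite ltnS leq_eqVlt => /predU1P[-> // | ltjn].
by rewrite [LHS]/= nth_rcons size_bernoulli_coefs ltjn IHn.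
Qed.

Lemma bernoulli_rec n :
  bernoulli n / (n`!)%:R =
    (n == 0%N)%:R - \sum_(j < n) bernoulli j / (j`!)%:R / ((n - j).+1`!)%:R.
Proof.
rewrite -(nth_bernoulli_coefs (ltnSn n)) [LHS]/=.
rewrite nth_rcons size_bernoulli_coefs ltnn eqxx; congr (_ - _).
by apply: eq_bigr => j _; rewrite nth_bernoulli_coefs.
Qed.

Lemma expm1_coef1 : expm1_coef 1 = 1.
Proof. exact: invr1. Qed.

Lemma bernoulliP : bernoulli_egf bernoulli.
Proof.
case=> [|n]; first by rewrite big_ord1 mulr0.
rewrite big_ord_recr /= subnn mulr0 addr0 big_ord_recr [val _]/= subSn // subnn.
rewrite expm1_coef1 mulr1 bernoulli_rec /= addrCA -[RHS]addr0; congr (_ + _).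
apply/eqP; rewrite subr_eq0; apply/eqP; apply: eq_bigr => j _.
by rewrite subSn // ltnW.
Qed.

Lemma bernoulli_unique B : bernoulli_egf B -> B =1 bernoulli.
Proof.
move=> HB n; elim/ltn_ind: n => n IHn.
have := HB n.+1; rewrite -(bernoulliP n.+1).
rewrite !(big_ord_recr n.+1) /= subnn !mulr0 !addr0 !(big_ord_recr n) /=.
rewrite subSn // subnn.
rewrite (eq_bigr (fun j : 'I_n => bernoulli j / (j`!)%:R * expm1_coef (n.+1 - j)));
  last by move=> j _; rewrite IHn.
move/addrI; rewrite expm1_coef1 !mulr1.
by apply: divIf; rewrite pnatr_eq0 -lt0n fact_gt0.
Qed.

(* j_N; denq is the positive denominator in lowest terms. *)
Definition jden (N : nat) : int := denq (bernoulli (2 * N) / (2 * N)%:R).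

(* Main.v *)
From HB Require Import structures.
Require Import Defs.
From mathcomp Require Import all_boot all_order all_algebra.
From mathcomp Require Import cyclic zify ring lra.

Import Order.TTheory GRing.Theory Num.Theory.
Local Open Scope ring_scope.

(** Integrality is checked one prime p at a time. Write b_n = B_n / n, and
    e = 1 - 1/p if p - 1 divides n, e = 0 otherwise. The number
    c*_n = (1 - p^(n-1)) b_n - e/n is p-integral, and (c*_(n+h) - c*_n) / h is
    p-integral whenever p - 1 divides h (divided by p once more if p >= 5).
    Substituting b_n = e/n + c_n with c_n = c*_n + p^(n-1) b_n, the terms
    without a c_n cancel and the remaining denominators are absorbed by these
    congruences, by the integer j_N b_m, and by the binomials: if
    k/2 <= w <= k-1, then l/2 divides (k/2) C(w, k/2) C(m/2-1, w). Only p = 2,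
    k = 2 is exceptional, where c_2 is not 2-integral and the term 1/2 enters.

    The congruences come from the umbral functional E(X^n) = B_n, for which
    p E(f) is the sum of the E(f(a + pX)) over a < p, so that
    p (1 - p^(n-1)) B_n is the sum over 0 < a < p of the E((a + pX)^n). Moving a
    to a^(p^L) changes E((a + pX)^n) by an explicit multiple of n p; after this
    the constant terms sum to (p - 1) or 0 modulo p^(L+1), and the other terms
    of the binomial expansion can be divided by n p. For p = 2 one has instead
    (1 - 2^(n-1)) B_n = E((1 + 4X)^n) / 2 for even n. *)

(** * Rational numbers integral at a prime *)

(** For prime [p], the localization of the integers at [p]. *)
Definition plocal (p : nat) : {pred rat} := fun x => coprime p `|denq x|%N.

(** Any denominator prime to [p] may be exhibited, not only the reduced one, which makes closure
    under sums and products easy. *)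
Lemma plocalP {p x} :
  reflect (exists2 d : nat, coprime p d & d%:R * x \is a Num.int) (x \in plocal p).
Proof.
apply: (iffP idP) => [cpd | [d cpd /intrP[n def_n]]].
  exists `|denq x|%N => //; rewrite -[_%:R]/((`|denq x|%N : int)%:~R) absz_denq.
  by rewrite mulrC -numqE intr_int.
suff dvd: (`|denq x| %| d)%N by apply: coprime_dvdr dvd cpd.
have /eqP: (d%:R * (numq x)%:~R = n%:~R * (denq x)%:~R :> rat).
  by rewrite numqE mulrA def_n.
rewrite -[d%:R]/((Posz d)%:~R) -!intrM eqr_int => /eqP def_dn.
rewrite -(@Gauss_dvdl _ _ `|numq x|); last by rewrite coprime_sym coprime_num_den.
by rewrite -[d]/(`|Posz d|%N) -abszM def_dn abszM dvdn_mull.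
Qed.

Lemma int_plocal p x : x \is a Num.int -> x \in plocal p.
Proof. by move=> xZ; apply/plocalP; exists 1%N; rewrite ?coprimen1 ?mul1r. Qed.

Fact plocal_subring p : subring_closed (plocal p).
Proof.
split=> [|x y /plocalP[d cd dxZ] /plocalP[e ce eyZ]|x y /plocalP[d cd dxZ] /plocalP[e ce eyZ]].
- exact/int_plocal/rpred1.
- apply/plocalP; exists (d * e)%N; first by rewrite coprimeMr cd.
  rewrite mulrBr natrM mulrAC -(mulrA _ _ y) rpredB // rpredM ?natr_int //.
- apply/plocalP; exists (d * e)%N; first by rewrite coprimeMr cd.
  by rewrite natrM mulrACA rpredM.
Qed.
HB.instance Definition _ p := GRing.isSubringClosed.Build rat (plocal p) (plocal_subring p).

Lemma nat_plocal p n : n%:R \in plocal p.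
Proof. exact: rpred_nat. Qed.

Lemma plocalV p d : coprime p d -> d%:R^-1 \in plocal p.
Proof.
move=> cpd; apply/plocalP; exists d => //.
by case: (eqVneq d%:R (0 : rat)) => [->|d0]; rewrite ?mul0r ?divff ?rpred0 ?rpred1.
Qed.

Lemma plocal_div p x d : coprime p d -> x \in plocal p -> x / d%:R \in plocal p.
Proof. by move=> cpd xI; rewrite rpredM ?plocalV. Qed.

Lemma rat_int_plocal x : (forall p, prime p -> x \in plocal p) -> x \is a Num.int.
Proof.
move=> xI; rewrite Qint_def.
have [|//] := leqP `|denq x| 1; last first.
  move=> /pdivP[p p_pr p_dvd]; have := xI p p_pr.
  by rewrite unfold_in /= prime_coprime // p_dvd.
by have := denq_gt0 x; case: (denq x) => // [[|[|n]]].
Qed.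

Lemma plocal_Xn_div {p n e} :
  prime p -> (0 < n)%N -> (logn p n <= e)%N -> p%:R ^+ e / n%:R \in plocal p.
Proof.
move=> p_pr n0 le_e; have p0 : p%:R != 0 :> rat by rewrite pnatr_eq0 -lt0n prime_gt0.
rewrite -{1}(partnC p n0) p_part natrM natrX -(subnK le_e) exprD invfM.
rewrite mulrA mulfK ?expf_neq0 // plocal_div ?rpredX ?nat_plocal //.
exact: pnat_coprime (pnat_id p_pr) (part_pnat _ _).
Qed.

Lemma ltn_log_self p n : (0 < n)%N -> (logn p n < n)%N.
Proof.
move=> n0; have [p_pr|/negPf np] := boolP (prime p); last by rewrite lognE np.
exact: leq_trans (ltn_expl _ (prime_gt1 p_pr)) (dvdn_leq n0 (pfactor_dvdnn p n)).
Qed.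

Lemma logn_leq {p n e} : prime p -> (0 < n)%N -> (n < p ^ e.+1)%N -> (logn p n <= e)%N.
Proof.
move=> p_pr n0 lt_n; rewrite -ltnS -(ltn_exp2l _ _ (prime_gt1 p_pr)).
by apply: leq_ltn_trans lt_n; apply: dvdn_leq n0 (pfactor_dvdnn p n).
Qed.

Lemma logn_fact_leq {p n} : prime p -> (p.-1 * logn p n`! <= n)%N.
Proof.
move=> p_pr; rewrite logn_fact //.
(* The last quotient of Legendre's sum is added to carry the induction: [p] times the next quotient
   never exceeds it. *)
suff H K : (p.-1 * \sum_(1 <= k < K.+1) n %/ p ^ k + n %/ p ^ K <= n)%N.
  exact: leq_trans (leq_addr _ _) (H n).
elim: K => [|K IH]; first by rewrite big_geq // muln0 expn0 divn1.
rewrite big_nat_recr //= mulnDr -addnA; apply: leq_trans IH.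
rewrite leq_add2l -[X in (_ + X <= _)%N]mul1n -mulnDl addn1 prednK ?prime_gt0 //.
by rewrite expnS mulnC (mulnC p) divnMA leq_divM.
Qed.

(** * The umbral functional of the Bernoulli numbers *)

Lemma natr_fact_neq0 n : (n`!)%:R != 0 :> rat.
Proof. by rewrite pnatr_eq0 -lt0n fact_gt0. Qed.

Lemma bin_factr n i : (i <= n)%N ->
  'C(n, i)%:R = (n`!)%:R / (i`!)%:R / ((n - i)`!)%:R :> rat.
Proof.
move=> le_in; rewrite -(bin_fact le_in) !natrM.
by field; rewrite !natr_fact_neq0.
Qed.

(** Multiplying coefficient [n] by [n!] turns one form into the other; the right-hand side is
    supported at [n = 1], where [1! = 1]. *)
Lemma bernoulli_egf_bin B :
  bernoulli_egf B <-> forall n, \sum_(i < n) 'C(n, i)%:R * B i = (n == 1%N)%:R.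
Proof.
have E n : \sum_(j < n.+1) B j / (j`!)%:R * expm1_coef (n - j)
    = (\sum_(i < n) 'C(n, i)%:R * B i) / (n`!)%:R.
  rewrite big_ord_recr /= subnn mulr0 addr0 mulr_suml; apply: eq_bigr => i _.
  rewrite bin_factr 1?ltnW // /expm1_coef; have := ltn_ord i; rewrite -subn_gt0; case: (n - i)%N => // d _.
  by field; rewrite !natr_fact_neq0.
have F n : (n == 1%N)%:R / (n`!)%:R = (n == 1%N)%:R :> rat.
  by case: eqP => [->|]; rewrite ?mul0r ?divr1.
split=> HB n; first by have := HB n; rewrite E -[RHS]F => /divIf-> //; apply: natr_fact_neq0.
by rewrite E HB F.
Qed.

Definition umbral (f : {poly rat}) : rat := \sum_(i < size f) f`_i * bernoulli i.

Lemma umbral_widen n (f : {poly rat}) : (size f <= n)%N ->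
  umbral f = \sum_(i < n) f`_i * bernoulli i.
Proof.
move=> le_fn; rewrite /umbral (big_ord_widen n (fun i => f`_i * bernoulli i)) //.
rewrite big_mkcond; apply: eq_bigr => i _.
by case: ltnP => // /(nth_default 0)->; rewrite mul0r.
Qed.

Fact umbral_is_linear : linear_for *%R umbral.
Proof.
move=> a f g; pose n := maxn (size (a *: f + g)) (maxn (size f) (size g)).
rewrite !(@umbral_widen n) ?leq_max ?leqnn ?orbT // mulr_sumr -big_split /=.
by apply: eq_bigr => i _; rewrite coefD coefZ mulrDl mulrA.
Qed.
HB.instance Definition _ := GRing.isLinear.Build rat {poly rat} rat *%R umbral
  umbral_is_linear.

Lemma umbralZ a f : umbral (a *: f) = a * umbral f.
Proof. exact: linearZ. Qed.

Lemma umbralXn n : umbral 'X^n = bernoulli n.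
Proof.
rewrite /umbral size_polyXn big_ord_recr /= coefXn eqxx mul1r big1 ?add0r // => i _.
by rewrite coefXn ltn_eqF ?mul0r.
Qed.

Lemma poly_ind_Xn (K : {poly rat} -> Prop) : K 0 ->
  (forall c n f, K f -> K (c *: 'X^n + f)) -> forall f, K f.
Proof.
move=> K0 KS f; rewrite -[f]coefK poly_def.
by elim/big_rec: _ => // i g _; apply: KS.
Qed.

(** On monomials this is the binomial recursion, whose right-hand side [(n == 1)] is the derivative
    of X^n at 0. *)
Lemma umbral_shift f : umbral (f \Po ('X + 1)) = umbral f + f^`().[0].
Proof.
elim/poly_ind_Xn: f => [|c n f IHf].
  by rewrite comp_poly0 deriv0 horner0 addr0.
rewrite comp_polyD comp_polyZ !linearD /= !umbralZ IHf hornerD derivZ hornerZ.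
rewrite [RHS]addrACA -mulrDr; congr (_ * _ + _); rewrite comp_Xn_poly umbralXn.
rewrite addrC exprDn linear_sum /= big_ord_recr /= subnn expr0 mul1r.
rewrite binn mulr1n umbralXn addrC; congr (_ + _); rewrite derivXn hornerMn hornerXn.
have <-: (n == 1%N)%:R = 0 ^+ n.-1 *+ n :> rat.
  by case: n => [|[|j]] //=; rewrite expr0n mul0rn.
rewrite -(bernoulli_egf_bin bernoulli).1; last exact: bernoulliP.
by apply: eq_bigr => j _; rewrite expr1n mul1r linearMn /= umbralXn mulr_natl.
Qed.

(* [uexp q a n] is [q ^+ n] times the Bernoulli polynomial of index [n] at [a / q]. *)
Definition uexp (q : rat) (a n : nat) : rat := umbral ((q *: 'X + a%:R%:P) ^+ n).

(* The left-hand side divided by [p] satisfies, by telescoping, the recursion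
   that characterizes the Bernoulli numbers. *)
Lemma sum_uexp p n : (0 < p)%N -> \sum_(a < p) uexp p%:R a n = p%:R * bernoulli n.
Proof.
move=> p0; rewrite /uexp; have pn0 : p%:R != 0 :> rat by rewrite pnatr_eq0 -lt0n.
pose P a : {poly rat} := p%:R *: 'X + a%:R%:P.
pose B n := p%:R^-1 * \sum_(a < p) umbral (P a ^+ n).
suff /bernoulli_unique/(_ n) <- : bernoulli_egf B by rewrite mulVKf.
apply/bernoulli_egf_bin => {}n; rewrite /B.
under eq_bigr do rewrite mulrCA; rewrite -mulr_sumr.
have step a : \sum_(i < n) 'C(n, i)%:R * umbral (P a ^+ i)
    = umbral (P a.+1 ^+ n) - umbral (P a ^+ n).
  have ->: P a.+1 = 1 + P a by rewrite /P -natr1 polyCD polyC1; ring.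
  rewrite exprDn linear_sum /= big_ord_recr /= subnn expr0 mul1r binn mulr1n addrK.
  by apply: eq_bigr => i _; rewrite expr1n mul1r linearMn /= mulr_natl.
under eq_bigr do rewrite mulr_sumr.
rewrite exchange_big /=; under eq_bigr do rewrite step.
rewrite -(big_mkord xpredT (fun a => umbral (P a.+1 ^+ n) - umbral (P a ^+ n))).
rewrite telescope_sumr //.
(* As p (X + 1) = p X + p, the two ends of the telescoping sum differ by a shift of X, hence by a
   derivative at 0. *)
have ->: P p = (P 0) \Po ('X + 1).
  by rewrite /P comp_polyD comp_polyZ comp_polyX comp_polyC scalerDr alg_polyC addr0.
rewrite -rmorphXn /= umbral_shift addrC addKr deriv_exp /P.
rewrite derivD derivZ derivX derivC addr0 alg_polyC hornerMn hornerM hornerC.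
rewrite horner_exp hornerD hornerZ hornerX hornerC mulr0 addr0.
case: n {step} => [|[|n]]; first by rewrite mulr0.
  by rewrite expr0 mulr1 mulVf.
by rewrite expr0n mulr0 mul0rn mulr0.
Qed.

Lemma uexpE q a n :
  uexp q a n = \sum_(i < n.+1) 'C(n, i)%:R * (q ^+ i * bernoulli i) * a%:R ^+ (n - i).
Proof.
rewrite /uexp addrC exprDn linear_sum /=; apply: eq_bigr => i _.
rewrite linearMn /= exprZn -polyC_exp mul_polyC scalerA umbralZ umbralXn.
by rewrite -mulr_natl; ring.
Qed.

(** Adding [q] to [a] substitutes X + 1 for X, so each of the [b] steps contributes a derivative at
    0. *)
Lemma uexp_shift (q a b n : nat) :
  uexp q%:R (a + q * b) n = uexp q%:R a n
    + n%:R * q%:R * \sum_(j < b) (a + q * j)%:R ^+ n.-1.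
Proof.
elim: b => [|b IHb]; first by rewrite muln0 addn0 big_ord0 mulr0 addr0.
rewrite big_ord_recr /= mulrDr addrA -IHb /uexp.
set P := (q%:R *: 'X + (a + q * b)%:R%:P : {poly rat}).
have ->: q%:R *: 'X + (a + q * b.+1)%:R%:P = P \Po ('X + 1) :> {poly rat}.
  rewrite comp_polyD comp_polyZ comp_polyX comp_polyC scalerDr alg_polyC -addrA -polyCD.
  by rewrite -natrD; congr (_ + _%:R%:P); lia.
rewrite -rmorphXn /= umbral_shift deriv_exp /P; congr (_ + _).
rewrite derivD derivZ derivX derivC addr0 alg_polyC hornerMn hornerM hornerC.
by rewrite horner_exp hornerD hornerZ hornerX hornerC mulr0 add0r -mulr_natl mulrA.
Qed.

Lemma uexp0 q n : uexp q 0 n = q ^+ n * bernoulli n.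
Proof. by rewrite /uexp addr0 exprZn umbralZ umbralXn. Qed.

(** * Small values and reflection *)

Lemma bernoulli0 : bernoulli 0 = 1.
Proof.
by have := (bernoulli_egf_bin bernoulli).1 bernoulliP 1%N; rewrite big_ord1 mul1r.
Qed.

Lemma bernoulli1 : bernoulli 1 = - 1 / 2.
Proof.
have := (bernoulli_egf_bin bernoulli).1 bernoulliP 2%N.
by rewrite !big_ord_recr big_ord0 /= bernoulli0 bin0 bin1; lra.
Qed.

Lemma bernoulli2 : bernoulli 2 = 1 / 6.
Proof.
have := (bernoulli_egf_bin bernoulli).1 bernoulliP 3%N.
rewrite !big_ord_recr big_ord0 /= bernoulli0 bernoulli1.
by rewrite (_ : 'C(3, 0) = 1)%N // (_ : 'C(3, 1) = 3)%N // (_ : 'C(3, 2) = 3)%N //; lra.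
Qed.

(** The values at the powers of -X - 1 again satisfy the Bernoulli recursion. This is the symmetry
    of Bernoulli polynomials under x -> 1 - x. *)
Lemma umbral_reflect f : umbral (f \Po (- 'X - 1)) = umbral f.
Proof.
elim/poly_ind_Xn: f => [|c n f IHf]; first by rewrite comp_poly0.
rewrite comp_polyD comp_polyZ !linearD /= !umbralZ {}IHf; congr (_ * _ + _).
rewrite comp_Xn_poly umbralXn.
suff H : bernoulli_egf (fun n => umbral ((- 'X - 1) ^+ n)) by rewrite -(bernoulli_unique H).
apply/bernoulli_egf_bin => {}n.
have ->: \sum_(i < n) 'C(n, i)%:R * umbral ((- 'X - 1) ^+ i)
    = umbral ((- 'X) ^+ n) - umbral ((- 'X - 1) ^+ n).
  have ->: (- 'X) ^+ n = (1 + (- 'X - 1)) ^+ n :> {poly rat} by congr (_ ^+ n); ring.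
  rewrite exprDn linear_sum /= big_ord_recr /= subnn expr0 mul1r binn mulr1n addrK.
  by apply: eq_bigr => i _; rewrite expr1n mul1r linearMn /= mulr_natl.
have ->: (- 'X - 1) ^+ n = (- 'X) ^+ n \Po ('X + 1) :> {poly rat}.
  by rewrite rmorphXn /= raddfN /= comp_polyX opprD.
rewrite umbral_shift opprD addrA subrr sub0r deriv_exp derivN derivX hornerMn hornerM.
rewrite hornerN hornerC horner_exp hornerN hornerX oppr0.
by case: n => [|[|n]]; rewrite ?mulr0n ?expr0n ?mulr0 ?mul0rn ?oppr0 //= mulr1n mulr1 opprK.
Qed.

(** In the relation [sum_uexp] for 4, reflection identifies the residues 1 and 3, and the residue 2
    reduces to the residue 1 modulo 2, which the relation for 2 determines. *)
Lemma umbral_odd4 n : (0 < n)%N -> ~~ odd n ->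
  (1 - 2%:R ^+ n.-1) * bernoulli n = uexp 4 1 n / 2.
Proof.
case: n => // n _ evn.
have E4 := sum_uexp 4 n.+1 isT; have E2 := sum_uexp 2 n.+1 isT.
have E3: uexp 4 3 n.+1 = uexp 4 1 n.+1.
  rewrite /uexp -umbral_reflect rmorphXn /= comp_polyD comp_polyZ comp_polyX comp_polyC.
  have ->: 4 *: (- 'X - 1) + 3%:R%:P = - (4 *: 'X + 1%:R%:P) :> {poly rat}.
    by rewrite -!mul_polyC !polyC_natr; ring.
  by rewrite exprNn -signr_odd (negPf evn) mul1r.
have E42 : uexp 4 2 n.+1 = 2 ^+ n.+1 * uexp 2 1 n.+1.
  rewrite /uexp -umbralZ -exprZn; congr (umbral (_ ^+ _)).
  by rewrite -!mul_polyC !polyC_natr; ring.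
have E5 : 4 ^+ n.+1 = 2 ^+ n.+1 * 2 ^+ n.+1 :> rat by rewrite -exprMn -natrM.
move: E4 E2; rewrite !big_ord_recr !big_ord0 /= !uexp0 E3 E42 E5 exprS.
set t := 2 ^+ n; set b := bernoulli _; set x := uexp 4 _ _; set y := uexp 2 _ _.
move=> E4 E2; have -> : x = (4 * b - 2 * t * (2 * t) * b - 2 * t * y) / 2.
  by rewrite -E4; field.
have -> : y = 2 * b - 2 * t * b by rewrite -E2; ring.
by field.
Qed.

(** * Power sums and binomial sums modulo prime powers *)

Lemma natr_neq0 {R : numDomainType} {n} : (0 < n)%N -> n%:R != 0 :> R.
Proof. by rewrite pnatr_eq0 -lt0n. Qed.

(** A weak von Staudt-Clausen theorem, by induction: moving the top terms of the expansions in
    [sum_uexp] to the other side leaves p B_n with the factor 1 - p^n, a unit at [p]; the other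
    terms are integer multiples of p^i B_i with i < n. *)
Lemma plocal_pbernoulli p n : prime p -> p%:R * bernoulli n \in plocal p.
Proof.
move=> p_pr; elim/ltn_ind: n => -[|n] IHn; first by rewrite bernoulli0 mulr1 nat_plocal.
have E := sum_uexp p n.+1 (prime_gt0 p_pr).
have p0 := prime_gt0 p_pr; have np : (p ^ n.+1 - 1)%N%:R = p%:R ^+ n.+1 - 1 :> rat.
  by rewrite natrB ?expn_gt0 ?p0 // natrX.
have cp : coprime p (p ^ n.+1 - 1).
  by rewrite coprime_sym subn1 -(coprime_pexpr _ _ (ltn0Sn n)) coprimePn // expn_gt0 p0.
suff H : (1 - p%:R ^+ n.+1) * (p%:R * bernoulli n.+1) \in plocal p.
  have -> : p%:R * bernoulli n.+1
      = - ((1 - p%:R ^+ n.+1) * (p%:R * bernoulli n.+1)) / (p ^ n.+1 - 1)%N%:R.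
    rewrite np -mulNr opprB mulrAC divff ?mul1r // -np natr_neq0 //.
    by rewrite subn_gt0 -[1%N](exp1n n.+1) ltn_exp2r // prime_gt1.
  by rewrite plocal_div // rpredN.
have -> : (1 - p%:R ^+ n.+1) * (p%:R * bernoulli n.+1)
    = \sum_(a < p) (uexp p%:R a n.+1 - p%:R ^+ n.+1 * bernoulli n.+1).
  by rewrite sumrB E sumr_const card_ord -mulr_natr; ring.
rewrite rpred_sum // => a _; rewrite uexpE big_ord_recr /= binn subnn expr0 mul1r mulr1 addrK.
rewrite rpred_sum // => -[[|i] /= lt_i] _.
  by rewrite bin0 bernoulli0 !mul1r rpredX ?nat_plocal.
rewrite exprSr -[p%:R ^+ i * _ * _]mulrA.
have pB := IHn i.+1 lt_i; have aI := nat_plocal p a; have pI := nat_plocal p p.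
have cI := nat_plocal p 'C(n.+1, i.+1).
by apply: rpredM (rpredX _ aI); apply: rpredM cI (rpredM (rpredX _ pI) pB).
Qed.

(** [i!] times the binomial is a falling factorial, a polynomial in [n] with integer coefficients,
    so its increment is a multiple of [h]. *)
Lemma bin_diff n h i : exists2 z : rat, z \is a Num.int &
  'C(n + h, i)%:R - 'C(n, i)%:R = h%:R * z / (i`!)%:R.
Proof.
have ffS m j : (m ^_ j.+1)%:R = (m ^_ j)%:R * (m%:R - j%:R) :> rat.
  rewrite ffactnSr natrM; case: (leqP j m) => [le_jm|lt_mj]; first by rewrite natrB.
  by rewrite ffact_small // !mul0r.
have [z zZ def_z] : exists2 z : rat, z \is a Num.int &
    ((n + h) ^_ i)%:R - (n ^_ i)%:R = h%:R * z.
  elim: i => [|i [z zZ def_z]]; first by exists 0; rewrite ?rpred0 // subrr mulr0.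
  exists (z * (n%:R - i%:R) + ((n + h) ^_ i)%:R).
    by rewrite rpredD ?rpredM ?rpredB ?natr_int.
  move: def_z; rewrite !ffS natrD; set A := ((n + h) ^_ i)%:R => def_z.
  by rewrite [RHS]mulrDr [h%:R * (z * _)]mulrA -def_z; ring.
by exists z; rewrite // -def_z -!bin_ffact !natrM -mulrBl mulfK // natr_fact_neq0.
Qed.

(** For suitable weights, what is left of E((a + q X)^(n+1)) after removing a^(n+1) and dividing by
    (n+1) q. *)
Definition dsum (w : nat -> rat) (a n : nat) : rat :=
  \sum_(i < n.+1) 'C(n, i)%:R * w i * a%:R ^+ (n - i).

Lemma uexp_dsum q a n : q != 0 ->
  uexp q a n.+1 = a%:R ^+ n.+1
    + n.+1%:R * q * dsum (fun i => q ^+ i * bernoulli i.+1 / i.+1%:R) a n.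
Proof.
move=> q0; rewrite uexpE big_ord_recl /= bin0 bernoulli0 subn0 !mul1r; congr (_ + _).
rewrite /dsum mulr_sumr; apply: eq_bigr => i _; rewrite /bump /= add1n subSS.
have -> : 'C(n.+1, i.+1)%:R = n.+1%:R * 'C(n, i)%:R / i.+1%:R :> rat.
  by rewrite -natrM (mul_bin_diag n.+1) natrM mulrAC mulfV ?mul1r // natr_neq0.
by rewrite exprS; field; rewrite nat1r natr_neq0.
Qed.

Lemma plocal_dsum p w a n : (forall i, w i \in plocal p) -> dsum w a n \in plocal p.
Proof. by move=> wI; rewrite rpred_sum // => i _; rewrite !rpredM ?rpredX ?nat_plocal. Qed.

(** The increment of the binomials yields [h / i!], absorbed by the weights, and the change in the
    power of [a] yields a^h - 1. At [i = 0] both binomials are 1, so only positive indices carry the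
    stronger condition. *)
Lemma dsum_diff p w (a n h P : nat) : (0 < h)%N -> (0 < P)%N ->
    (forall i, w i \in plocal p) ->
    (forall i, (0 < i)%N -> w i / ((i`!)%:R * P%:R) \in plocal p) ->
    (a%:R ^+ h - 1) / (h%:R * P%:R) \in plocal p ->
  (dsum w a (n + h) - dsum w a n) / (h%:R * P%:R) \in plocal p.
Proof.
move=> h0 P0 wI wPI aI.
have h0' : h%:R != 0 :> rat by rewrite natr_neq0.
have P0' : P%:R != 0 :> rat by rewrite natr_neq0.
have E : dsum w a n * a%:R ^+ h
    = \sum_(i < (n + h).+1) 'C(n, i)%:R * w i * a%:R ^+ (n + h - i).
  rewrite -addSn big_split_ord /= [X in _ = _ + X]big1 ?addr0; last first.
    by move=> i _; rewrite bin_small ?mul0r //; lia.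
  rewrite /dsum mulr_suml; apply: eq_bigr => i _; rewrite -mulrA -exprD; congr (_ * _ ^+ _).
  by have := ltn_ord i; lia.
have -> : dsum w a (n + h) - dsum w a n
    = (dsum w a (n + h) - dsum w a n * a%:R ^+ h) + dsum w a n * (a%:R ^+ h - 1) by ring.
rewrite mulrDl rpredD //; last by rewrite -mulrA rpredM ?plocal_dsum.
rewrite E /dsum -sumrB mulr_suml rpred_sum // => -[[|i] /= _] _.
  by rewrite !bin0 subrr mul0r rpred0.
have [z zZ def_z] := bin_diff n h i.+1; rewrite -!mulrBl def_z.
have -> : h%:R * z / (i.+1)`!%:R * w i.+1 * a%:R ^+ (n + h - i.+1) / (h%:R * P%:R)
   = z * (w i.+1 / ((i.+1)`!%:R * P%:R)) * a%:R ^+ (n + h - i.+1).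
  by field; rewrite h0' P0' natr_fact_neq0.
apply: rpredM (rpredX _ (nat_plocal p a)).
by apply: rpredM (wPI i.+1 isT); apply: int_plocal.
Qed.

(** If p^v is the exact power of [p] in [h], the totient (p - 1) p^v of p^(v+1) divides [h], and
    Euler's theorem applies modulo p^(v+1). *)
Lemma plocal_expB1 p x h : prime p -> coprime p x -> (p.-1 %| h)%N -> (0 < h)%N ->
  (x%:R ^+ h - 1) / (h%:R * p%:R) \in plocal p.
Proof.
move=> p_pr cpx dv h0; have p0 := prime_gt0 p_pr; have p1 := prime_gt1 p_pr.
have x0 : (0 < x)%N by case: x cpx => //; rewrite /coprime gcdn0 => /eqP p1'; rewrite p1' in p1.
have lg : logn p (h * p) = (logn p h).+1.
  by rewrite lognM // (logn_prime p p_pr) eqxx addn1.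
have : (totient (p ^ logn p (h * p)) %| h)%N.
  rewrite lg totient_pfactor // Gauss_dvd ?dv ?pfactor_dvdnn // coprimeXr //.
  by rewrite coprime_sym -[X in coprime X](prednK p0) coprimeSn.
move=> /dvdnP[c def_h].
have : (p ^ logn p (h * p) %| x ^ h - 1)%N.
  have: coprime x (p ^ logn p (h * p)) by rewrite coprimeXr // coprime_sym.
  move: (p ^ _)%N def_h => q def_h /Euler_exp_totient eul.
  rewrite -eqn_mod_dvd ?expn_gt0 ?x0 // def_h mulnC expnM -modnXm eul modnXm exp1n.
  by [].
move=> /dvdnP[d def_d].
have -> : x%:R ^+ h - 1 = d%:R * p%:R ^+ logn p (h * p) :> rat.
  by rewrite -!natrX -natrM -def_d natrB ?expn_gt0 ?x0 // natrX.
rewrite -mulrA -natrM; apply: rpredM (nat_plocal p d) (plocal_Xn_div p_pr _ _) => //.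
by rewrite muln_gt0 h0.
Qed.

Lemma int_expB (q : rat) (x y k : nat) :
  (x%:R - y%:R) / q \is a Num.int -> (x%:R ^+ k - y%:R ^+ k) / q \is a Num.int.
Proof.
move=> xyZ; rewrite subrXX mulrAC rpredM // rpred_sum // => i _.
by rewrite rpredM ?rpredX ?natr_int.
Qed.

Lemma int_expB_lift p L (x y : nat) : (0 < p)%N ->
    (x%:R - y%:R) / p%:R \is a @Num.int rat ->
  (x%:R ^+ (p ^ L) - y%:R ^+ (p ^ L)) / p%:R ^+ L.+1 \is a @Num.int rat.
Proof.
move=> p0 xyZ; have p0' : p%:R != 0 :> rat by rewrite natr_neq0.
elim: L => [|L IHL]; first by rewrite !expr1.
rewrite expnSr !exprM subrXX [p%:R ^+ L.+2]exprSr invfM mulrACA rpredM //.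
have XYZ : ((x ^ p ^ L)%:R - (y ^ p ^ L)%:R) / p%:R \is a @Num.int rat.
  by rewrite !natrX int_expB.
rewrite -!natrX.
(* The two bases X and Y agree modulo [p], so the cofactor of X - Y is p Y^(p-1) = 0 modulo [p]. *)
have -> : \sum_(i < p) (x ^ p ^ L)%:R ^+ (p.-1 - i) * (y ^ p ^ L)%:R ^+ i
    = \sum_(i < p) ((x ^ p ^ L)%:R ^+ (p.-1 - i) - (y ^ p ^ L)%:R ^+ (p.-1 - i))
          * (y ^ p ^ L)%:R ^+ i + p%:R * (y ^ p ^ L)%:R ^+ p.-1 :> rat.
  under [in RHS]eq_bigr do rewrite mulrBl.
  rewrite sumrB -addrA -[LHS]addr0; congr (_ + _); apply/esym/eqP.
  rewrite addrC subr_eq0 mulr_natl -[p in _ *+ p]card_ord -sumr_const; apply/eqP.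
  by apply: eq_bigr => i _; rewrite -exprD subnK // -ltnS prednK.
rewrite mulrDl rpredD //; last by rewrite mulrAC mulfV // mul1r rpredX ?natr_int.
rewrite mulr_suml rpred_sum // => i _; rewrite mulrAC rpredM ?rpredX ?natr_int //.
exact: int_expB.
Qed.

Lemma natr_mod_int p x y : (0 < p)%N -> x = y %[mod p] ->
  (x%:R - y%:R) / p%:R \is a @Num.int rat.
Proof.
move=> p0 xy; have p0' : p%:R != 0 :> rat by rewrite natr_neq0.
rewrite {1}(divn_eq x p) {1}(divn_eq y p) xy !natrD opprD addrACA subrr addr0 !natrM -mulrBl.
by rewrite mulfK // rpredB ?natr_int.
Qed.

(** By Fermat [n] may be reduced to r = n mod (p - 1), where 0 < r < p - 1; then X^r - 1 cannot
    vanish at all p - 1 nonzero elements of the field. *)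
Lemma exists_nonroot p n : prime p -> ~~ (p.-1 %| n)%N ->
  exists2 g : nat, coprime p g & coprime p (g ^ n - 1).
Proof.
move=> p_pr ndiv; have p1 := prime_gt1 p_pr; have p0 := prime_gt0 p_pr.
have pch : p \in [pchar 'F_p] by apply: pchar_Fp.
pose r := (n %% p.-1)%N; have r0 : (0 < r)%N by rewrite lt0n.
have lt_r : (r < p.-1)%N by rewrite ltn_pmod //; case: p p_pr p1 {pch ndiv r r0 p0} => [|[]].
have [/existsP[x /andP[x0 xr]]|] := boolP [exists x : 'F_p, (x != 0) && (x ^+ r != 1)].
  have cpx : coprime p x by rewrite prime_coprime // (dvdn_pcharf pch) natr_Zp.
  exists (x : nat) => //; rewrite prime_coprime // (dvdn_pcharf pch).
  have x_gt0 : (0 < x)%N by rewrite lt0n; apply: contraNneq x0 => x_eq0; apply/eqP/val_inj.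
  rewrite natrB ?expn_gt0 ?x_gt0 // subr_eq0 (divn_eq n p.-1) expnD natrM.
  have -> : (x ^ (n %/ p.-1 * p.-1))%:R = 1 :> 'F_p.
    rewrite mulnC expnM natrX.
    have : (x ^ p.-1 = 1 %[mod p])%N.
      by rewrite -totient_prime // Euler_exp_totient // coprime_sym.
    move/eqP; rewrite eqn_mod_dvd ?expn_gt0 ?x_gt0 // (dvdn_pcharf pch).
    by rewrite natrB ?expn_gt0 ?x_gt0 // subr_eq0 => /eqP->; rewrite expr1n.
  by rewrite mul1r natrX natr_Zp.
rewrite negb_exists => /forallP xr1.
pose f : {poly 'F_p} := 'X^r - 1.
pose s := [seq x <- enum 'F_p | x != 0].
have sz_f : size f = r.+1 by rewrite /f -polyC1 size_XnsubC.
have f0 : f != 0 by rewrite -size_poly_eq0 sz_f.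
have sz_s : size s = p.-1.
  have : size s = #|predC1 (0 : 'F_p)|.
    rewrite cardE; apply/perm_size/uniq_perm => [||x]; try exact: enum_uniq.
      exact/filter_uniq/enum_uniq.
    by rewrite mem_filter !mem_enum !inE andbT.
  by rewrite cardC1 card_Fp.
have all_s : all (root f) s.
  apply/allP => x; rewrite mem_filter => /andP[x0 _].
  by have := xr1 x; rewrite x0 negbK rootE !hornerE subr_eq0.
have := max_poly_roots f0 all_s (filter_uniq _ (enum_uniq _)).
by rewrite sz_f sz_s ltnNge lt_r.
Qed.

(** If p - 1 divides [n], every term is 1 modulo p^(L+1). Otherwise multiplication by [g] permutes
    the residues and multiplies the sum by g^(n p^L) modulo p^(L+1), while g^(n p^L) - 1 is a unit
    at [p]. *)
Lemma sum_teichmuller p n L : prime p -> (0 < n)%N ->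
  (\sum_(a < p | a != 0 :> nat) (a ^ p ^ L)%:R ^+ n - (if (p.-1 %| n)%N then p.-1%:R else 0))
    / p%:R ^+ L.+1 \in plocal p.
Proof.
move=> p_pr n0; have p0 := prime_gt0 p_pr; have p0' : p%:R != 0 :> rat by rewrite natr_neq0.
have cpa (a : 'I_p) : a != 0 :> nat -> coprime p a.
  by move=> a0; rewrite prime_coprime // gtnNdvd // lt0n.
have [dv|ndv] := boolP (p.-1 %| n)%N.
  have -> : p.-1%:R = \sum_(a < p | a != 0 :> nat) 1 :> rat.
    by rewrite -(prednK p0) big_mkcond big_ord_recl /= add0r sumr_const card_ord.
  rewrite -sumrB mulr_suml rpred_sum // => a a0; have {a0}cpa := cpa a a0.
  have h0 : (0 < p ^ L * n)%N by rewrite muln_gt0 expn_gt0 p0.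
  have -> : ((a ^ p ^ L)%:R ^+ n - 1) / p%:R ^+ L.+1
      = n%:R * ((a%:R ^+ (p ^ L * n) - 1) / ((p ^ L * n)%:R * p%:R)) :> rat.
    by rewrite natrM !natrX exprM exprSr; field; rewrite p0' expf_neq0 // natr_neq0.
  have H := plocal_expB1 p a _ p_pr cpa (dvdn_mull (p ^ L) dv) h0.
  by apply: rpredM H; apply: nat_plocal.
rewrite subr0.
have [g cpg cpgn] := exists_nonroot p n p_pr ndv.
pose s (a : 'I_p) : 'I_p := Ordinal (ltn_pmod (g * a) p0).
have s_inj : injective s.
  suff H (a b : 'I_p) : (a <= b)%N -> s a = s b -> a = b.
    by move=> a b; case: (leqP a b) => [/H//|/ltnW/H + /esym] => /[apply].
  move=> le_ab [] /eqP; rewrite eq_sym eqn_mod_dvd ?leq_mul2l ?le_ab ?orbT // -mulnBr.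
  rewrite Gauss_dvdr // => dv; apply/val_inj/eqP; rewrite /= eqn_leq le_ab /= -subn_eq0.
  by apply: contraTT dv => ba0; rewrite gtnNdvd ?lt0n //; have := ltn_ord b; lia.
have E0 : (0 < p ^ L * n)%N by rewrite muln_gt0 expn_gt0 p0.
have -> : \sum_(a < p | a != 0 :> nat) (a ^ p ^ L)%:R ^+ n
    = \sum_(a < p) (a%:R ^+ (p ^ L)) ^+ n :> rat.
  rewrite big_mkcond; apply: eq_bigr => a _; rewrite natrX; case: eqP => [->|//].
  by rewrite /= -exprM expr0n gtn_eqF.
set T := \sum_(_ < _) _.
have gT : T * ((g ^ p ^ L)%:R ^+ n - 1) / p%:R ^+ L.+1 \in plocal p.
  have -> : T * ((g ^ p ^ L)%:R ^+ n - 1)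
      = \sum_(a < p) (((g * a)%N%:R ^+ (p ^ L)) ^+ n - ((s a)%:R ^+ (p ^ L)) ^+ n).
    rewrite sumrB mulrBr mulr1; congr (_ - _); last by rewrite /T (reindex_inj s_inj).
    by rewrite mulrC mulr_sumr; apply: eq_bigr => a _; rewrite natrM natrX !exprMn.
  (* [g * a] and [s a] agree modulo [p], hence their powers of exponent p^L agree modulo p^(L+1). *)
  rewrite mulr_suml rpred_sum // => a _; rewrite -!natrX !(natrX _ _ n) int_plocal //.
  by rewrite int_expB // !natrX int_expB_lift // natr_mod_int //= modn_mod.
have g0 : (0 < g)%N.
  by case: g cpg {cpgn s s_inj gT} => //; rewrite /coprime gcdn0 => /eqP p1; rewrite p1 in p_pr.
have gg : coprime p ((g ^ p ^ L) ^ n - 1).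
  rewrite prime_coprime // -eqn_mod_dvd ?expn_gt0 ?g0 // -modnXm.
  have -> : g ^ p ^ L = g %[mod p].
    elim: L {E0 T gT} => [|L IHL]; first by rewrite expn1.
    by rewrite expnSr expnM fermat_little.
  by rewrite modnXm eqn_mod_dvd ?expn_gt0 ?g0 // -prime_coprime.
have -> : T / p%:R ^+ L.+1
    = T * ((g ^ p ^ L)%:R ^+ n - 1) / p%:R ^+ L.+1 / ((g ^ p ^ L) ^ n - 1)%N%:R.
  have g1 : (0 < (g ^ p ^ L) ^ n - 1)%N.
    by case: (_ - 1)%N gg => // ; rewrite /coprime gcdn0 => /eqP p1; rewrite p1 in p_pr.
  have E : ((g ^ p ^ L) ^ n - 1)%N%:R = (g ^ p ^ L)%:R ^+ n - 1 :> rat.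
    by rewrite natrB ?natrX // !expn_gt0 g0.
  by rewrite -E mulrAC mulfK // natr_neq0.
exact: plocal_div.
Qed.

(** * The numbers c*_n and the weights of their expansions *)

Definition beta (n : nat) : rat := bernoulli n / n%:R.

Definition eps (p n : nat) : rat := if (p.-1 %| n)%N then 1 - p%:R^-1 else 0.

(** For n > 1, up to sign, the zeta value at 1 - n without its Euler factor at [p], less the polar
    term of the p-adic zeta function, whose residue is 1 - 1/p. *)
Definition cstar (p n : nat) : rat := (1 - p%:R ^+ n.-1) * beta n - eps p n / n%:R.

(* [p] is excluded for [p = 3]: the weight [3 * B_2 / 2] of index 1 is a 3-adic unit. *)
Definition kmod (p : nat) : nat := if (p < 5)%N then 1%N else p.

Definition weight (q : nat) (i : nat) : rat := q%:R ^+ i * bernoulli i.+1 / i.+1%:R.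

(** The quotient of the weight by [i!] is p^(i-1) / (i+1)! times the p-integral p B_(i+1), and
    Legendre's bound controls (i+1)!. *)
Lemma weight_fact_odd p i : prime p -> odd p -> (0 < i)%N ->
  weight p i / ((i`!)%:R * (kmod p)%:R) \in plocal p.
Proof.
move=> p_pr p_odd i0; have p0' : p%:R != 0 :> rat by rewrite natr_neq0 ?prime_gt0.
have p3 : (2 < p)%N by rewrite odd_prime_gt2.
have logi := logn_fact_leq (n := i.+1) p_pr.
have f0 : (0 < (i.+1)`!)%N by rewrite fact_gt0.
have lg2 : logn p 2`! = 0%N by rewrite (logn_prime p (isT : prime 2)) gtn_eqF.
have lg3 : (3 < p)%N -> logn p 3`! = 0%N.
  move=> lt3; apply/eqP; rewrite -leqn0; apply: leq_trans (_ : 3 %/ p.-1 <= 0)%N; last first.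
    by rewrite leqn0 divn_small //; lia.
  have p1 : (0 < p.-1)%N by lia.
  by rewrite leq_divRL // mulnC; apply: logn_fact_leq p_pr.
have wE : weight p i / (i`!)%:R = p%:R ^+ i.-1 / ((i.+1)`!)%:R * (p%:R * bernoulli i.+1).
  case: i i0 {logi f0} => // i _; rewrite /weight [(i.+2)`!]factS natrM [p%:R ^+ i.+1]exprSr.
  by field; rewrite natr_fact_neq0 -natrD natr_neq0.
rewrite invfM mulrA wE /kmod; case: ifPn => p5.
  rewrite invr1 mulr1; apply: rpredM (plocal_pbernoulli _ _ p_pr).
  apply: plocal_Xn_div => //; case: i i0 logi {f0 wE} => [|[|i]] // _; first by rewrite lg2.
  by nia.
(* At index 1 the bound is one power of [p] short, but B_2 = 1/6 is itself p-integral for p >= 5. *)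
have [i1|i1] := leqP i 1.
  have -> : i = 1%N by lia.
  rewrite bernoulli2 expr0 (_ : 2`! = 2)%N // (_ : _ / p%:R = (2 * (2 * 3))%N%:R^-1); last first.
    by rewrite !natrM; field.
  by rewrite plocalV // !coprimeMr !prime_coprime // !gtnNdvd //; lia.
rewrite mulrAC; apply: rpredM (plocal_pbernoulli _ _ p_pr).
have -> : p%:R ^+ i.-1 / (i.+1)`!%:R / p%:R = p%:R ^+ i.-2 / (i.+1)`!%:R :> rat.
  case: i i1 {i0 logi f0 wE} => [|[|i]] //= _.
  by rewrite exprSr; field; rewrite p0' natr_fact_neq0.
apply: plocal_Xn_div => //; case: i i1 logi {i0 f0 wE} => [|[|[|i]]] // _.
  by rewrite lg3 //; lia.
rewrite /=; nia.
Qed.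

(** * Kummer congruences *)

Lemma kmod_gt0 p : (0 < kmod p)%N.
Proof. by case: p => [|p] //; rewrite /kmod; case: ifP. Qed.

Lemma weight_odd p i : prime p -> odd p -> weight p i \in plocal p.
Proof.
move=> p_pr p_odd; case: (posnP i) => [->|i0].
  rewrite /weight mul1r divr1 bernoulli1 plocal_div //; first by rewrite coprimen2.
  by rewrite rpredN rpred1.
have /(rpredM (nat_plocal p (i`! * kmod p))) := weight_fact_odd p i p_pr p_odd i0.
have k0 : (0 < i`! * kmod p)%N by rewrite muln_gt0 fact_gt0 kmod_gt0.
by rewrite -natrM mulrC divfK // natr_neq0.
Qed.

(* [a ^ p ^ L] approximates the Teichmuller representative of [a]. *)
Definition regsum (p L n : nat) : rat :=
  \sum_(a < p | a != 0 :> nat)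
    (dsum (weight p) (a ^ p ^ L) n
     - \sum_(j < (a ^ p ^ L - a) %/ p) (a + p * j)%:R ^+ n).

(** Divide [sum_uexp], without the term a = 0, by (n+1) p, after moving each a to a^(p^L), which is
    congruent to it by Fermat. The constant terms give the polar term up to an error
    [t * p ^ L / (n+1)]. *)
Lemma cstar_regsum p L n : prime p -> odd p -> exists2 t : rat, t \in plocal p &
  cstar p n.+1 = regsum p L n + t * p%:R ^+ L / n.+1%:R.
Proof.
move=> p_pr p_odd; have p0 := prime_gt0 p_pr.
have p0' : p%:R != 0 :> rat by rewrite natr_neq0.
have n0' : n.+1%:R != 0 :> rat by rewrite natr_neq0.
pose T : rat := \sum_(a < p | a != 0 :> nat) (a ^ p ^ L)%:R ^+ n.+1.
exists ((T - (if (p.-1 %| n.+1)%N then p.-1%:R else 0)) / p%:R ^+ L.+1).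
  exact: sum_teichmuller.
have shift (a : 'I_p) : uexp p%:R a n.+1 = (a ^ p ^ L)%:R ^+ n.+1
    + n.+1%:R * p%:R * (dsum (weight p) (a ^ p ^ L) n
     - \sum_(j < (a ^ p ^ L - a) %/ p) (a + p * j)%:R ^+ n).
  have le_a : (a <= a ^ p ^ L)%N.
    case: (nat_of_ord a) => // b; rewrite -{1}[b.+1]expn1 leq_pexp2l //.
    by rewrite expn_gt0 p0.
  have fer K : (a ^ p ^ K = a %[mod p])%N.
    by elim: K => [|K IHK]; rewrite ?expn1 // expnSr expnM fermat_little.
  have dv : (p %| a ^ p ^ L - a)%N by rewrite -eqn_mod_dvd //; apply/eqP/fer.
  have E1 : uexp p%:R (a ^ p ^ L) n.+1 = (a ^ p ^ L)%:R ^+ n.+1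
      + n.+1%:R * p%:R * dsum (weight p) (a ^ p ^ L) n by apply: uexp_dsum.
  have E2 := uexp_shift p a ((a ^ p ^ L - a) %/ p) n.+1.
  rewrite mulnC divnK // subnKC // E1 /= in E2.
  by rewrite mulrBr addrA E2 addrK.
have := sum_uexp p n.+1 p0.
rewrite (bigID (fun a : 'I_p => a != 0 :> nat)) /= addrC.
have -> : \sum_(a < p | ~~ (a != 0 :> nat)) uexp p%:R a n.+1 = p%:R ^+ n.+1 * bernoulli n.+1.
  rewrite (big_pred1 (Ordinal p0)) /= ?uexp0 // => a.
  by rewrite negbK.
under eq_bigr do rewrite shift.
rewrite big_split /= -/T -mulr_sumr -/(regsum p L n) => E.
have -> : cstar p n.+1
    = (p%:R * bernoulli n.+1 - p%:R ^+ n.+1 * bernoulli n.+1) / (n.+1%:R * p%:R)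
      - eps p n.+1 / n.+1%:R.
  by rewrite /cstar /beta exprS; field; rewrite p0' nat1r n0'.
have -> : eps p n.+1 = (if (p.-1 %| n.+1)%N then p.-1%:R else 0) / p%:R.
  rewrite /eps; case: ifP => _; last by rewrite mul0r.
  by rewrite -subn1 natrB // mulrBl divff // mul1r.
rewrite -E [p%:R ^+ L.+1]exprS; set e := if _ then _ else _.
set b := _ * bernoulli _; set r := regsum _ _ _.
have pL : p%:R ^+ L != 0 :> rat by rewrite expf_neq0.
move: e b r T n0' pL p0' {shift E} => e b r T.
move: (n.+1%:R : rat) (p%:R : rat) => N q N0 P0 q0.
by field; rewrite N0 P0 q0.
Qed.

Lemma regsum_plocal p L n : prime p -> odd p -> regsum p L n \in plocal p.
Proof.
move=> p_pr p_odd; rewrite rpred_sum // => a _; apply: rpredB.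
  by apply: plocal_dsum => i; apply: weight_odd.
by rewrite rpred_sum // => j _; rewrite rpredX ?nat_plocal.
Qed.

Lemma coprime_ord p (a : 'I_p) : prime p -> a != 0 :> nat -> coprime p a.
Proof. by move=> p_pr a0; rewrite prime_coprime // gtnNdvd // lt0n. Qed.

Lemma plocal_expB1_kmod p x h : prime p -> coprime p x -> (p.-1 %| h)%N -> (0 < h)%N ->
  (x%:R ^+ h - 1) / (h%:R * (kmod p)%:R) \in plocal p.
Proof.
move=> p_pr cpx dv h0; have H := plocal_expB1 p x h p_pr cpx dv h0.
rewrite /kmod; case: ifP => _ //; rewrite mulr1.
have -> : (x%:R ^+ h - 1) / h%:R = p%:R * ((x%:R ^+ h - 1) / (h%:R * p%:R)) :> rat.
  by field; rewrite !natr_neq0 // prime_gt0.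
exact: rpredM (nat_plocal p p) H.
Qed.

Lemma regsum_diff p L n h : prime p -> odd p -> (p.-1 %| h)%N -> (0 < h)%N ->
  (regsum p L (n + h) - regsum p L n) / (h%:R * (kmod p)%:R) \in plocal p.
Proof.
move=> p_pr p_odd dv h0; rewrite -sumrB mulr_suml rpred_sum // => a a0.
have cpa := coprime_ord p a p_pr a0; have k0 := kmod_gt0 p.
have E (x y z t d : rat) : (x - y - (z - t)) / d = (x - z) / d - (y - t) / d by ring.
rewrite E; apply: rpredB.
  apply: dsum_diff => // [i|i|]; [exact: weight_odd|exact: weight_fact_odd|].
  by apply: plocal_expB1_kmod => //; rewrite coprimeXr.
rewrite -sumrB mulr_suml rpred_sum // => j _; rewrite exprD -{2}[_ ^+ n]mulr1 -mulrBr -mulrA.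
apply: rpredM; first by rewrite rpredX ?nat_plocal.
apply: plocal_expB1_kmod => //; rewrite addnC mulnC.
by rewrite /coprime gcdnMDl.
Qed.

Lemma cstar_odd p n h : prime p -> odd p -> (p.-1 %| h)%N -> (0 < h)%N -> (0 < n)%N ->
  cstar p n \in plocal p
  /\ (cstar p (n + h) - cstar p n) / (h%:R * (kmod p)%:R) \in plocal p.
Proof.
move=> p_pr p_odd dv h0; case: n => // n _.
(* [L] need only be so large that p^L absorbs the denominators of both error terms; these divide
   [M], and a valuation is less than the number itself. *)
pose M := (n.+1 * (n.+1 + h) * (h * kmod p))%N; pose L := M.
have k0 := kmod_gt0 p; have hk0 : (0 < h * kmod p)%N by rewrite muln_gt0 h0.
have M0 : (0 < M)%N by rewrite !muln_gt0 h0.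
have LI d : (0 < d)%N -> (d %| M)%N -> p%:R ^+ L / d%:R \in plocal p.
  move=> d0 dM; apply: plocal_Xn_div => //.
  by apply: leq_trans (ltnW (ltn_log_self p d d0)) (dvdn_leq M0 dM).
have [t tI ->] := cstar_regsum p L n p_pr p_odd.
have [t' tI'] := cstar_regsum p L (n + h) p_pr p_odd; rewrite addSn => ->.
split; first by rewrite rpredD ?regsum_plocal // -mulrA; apply: rpredM tI (LI _ _ _); rewrite // /M -mulnA dvdn_mulr.
have E : (regsum p L (n + h) + t' * p%:R ^+ L / (n + h).+1%:R
      - (regsum p L n + t * p%:R ^+ L / n.+1%:R)) / (h%:R * (kmod p)%:R)
    = (regsum p L (n + h) - regsum p L n) / (h%:R * (kmod p)%:R)
      + (t' * (p%:R ^+ L / ((n + h).+1 * (h * kmod p))%:R)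
         - t * (p%:R ^+ L / (n.+1 * (h * kmod p))%:R)).
  rewrite !natrM; have := natr_neq0 (R := rat) h0; have := natr_neq0 (R := rat) k0.
  have := natr_neq0 (R := rat) (ltn0Sn n); have := natr_neq0 (R := rat) (ltn0Sn (n + h)).
  move: (n.+1%:R : rat) ((n + h).+1%:R : rat) => N N' N'0 N0 K0 H0.
  by field; rewrite N'0 N0 K0 H0.
rewrite E rpredD ?regsum_diff // rpredB //.
  by apply: rpredM tI' (LI _ _ _); rewrite ?muln_gt0 ?h0 ?k0 // /M -mulnA dvdn_mull.
apply: rpredM tI (LI _ _ _); rewrite ?muln_gt0 ?h0 ?k0 // /M mulnAC dvdn_mulr //.
Qed.

Lemma weight2 i : (0 < i)%N -> 2 * weight 4 i / (i`!)%:R \in plocal 2.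
Proof.
move=> i0; have -> : 2 * weight 4 i / (i`!)%:R
    = 2%:R ^+ i.*2 / ((i.+1)`!)%:R * (2%:R * bernoulli i.+1).
  rewrite /weight -muln2 mulnC exprM -natrX [(i.+1)`!]factS natrM.
  by field; rewrite natr_fact_neq0 nat1r natr_neq0.
apply: rpredM (plocal_pbernoulli 2 _ isT); apply: plocal_Xn_div; rewrite ?fact_gt0 //.
by have := logn_fact_leq (n := i.+1) (isT : prime 2); lia.
Qed.

Lemma weight2_plocal i : 2 * weight 4 i \in plocal 2.
Proof.
case: (posnP i) => [->|i0].
  by rewrite /weight mul1r divr1 bernoulli1 mulrC divfK // rpredN rpred1.
have := rpredM (nat_plocal 2 i`!) (weight2 i i0).
by rewrite mulrC divfK // natr_fact_neq0.
Qed.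

(** The constant term 1 of E((1 + 4X)^(n+1)) contributes 1 / (2 (n+1)), which is exactly the polar
    term at 2. *)
Lemma cstar2_dsum n : odd n -> cstar 2 n.+1 = dsum (fun i => 2 * weight 4 i) 1 n.
Proof.
move=> n_odd; rewrite /cstar /beta mulrA umbral_odd4 //= ?n_odd // uexp_dsum //.
have -> : dsum (fun i => 2 * weight 4 i) 1 n = 2 * dsum (weight 4) 1 n.
  by rewrite /dsum mulr_sumr; apply: eq_bigr => i _; ring.
rewrite /eps dvd1n expr1n -/(weight 4).
by have := natr_neq0 (R := rat) (ltn0Sn n); move: (n.+1%:R : rat) => N N0; field.
Qed.

Lemma cstar_two n h : odd n -> ~~ odd h -> (0 < h)%N ->
  cstar 2 n.+1 \in plocal 2
  /\ (cstar 2 (n + h).+1 - cstar 2 n.+1) / (h%:R * (kmod 2)%:R) \in plocal 2.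
Proof.
move=> n_odd h_even h0; rewrite !cstar2_dsum ?oddD ?n_odd //.
split; first by apply: plocal_dsum => i; apply: weight2_plocal.
apply: dsum_diff => // [i|i i0|]; first exact: weight2_plocal.
  by rewrite mulr1 weight2.
by rewrite expr1n subrr mul0r rpred0.
Qed.

(** * Local integrality of the theorem's expression *)

Lemma cstar_kummer p n h : prime p -> (0 < n)%N -> ~~ odd n -> (0 < h)%N -> ~~ odd h ->
    (p.-1 %| h)%N ->
  cstar p n \in plocal p
  /\ (cstar p (n + h) - cstar p n) / (h%:R * (kmod p)%:R) \in plocal p.
Proof.
move=> p_pr n0 n_even h0 h_even dv; have [p2|p_odd] := even_prime p_pr.
  by rewrite p2; case: n n0 n_even => // n _; rewrite /= negbK => n_odd; apply: cstar_two.
exact: cstar_odd.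
Qed.

Lemma cstar_plocal p n : prime p -> (0 < n)%N -> ~~ odd n -> cstar p n \in plocal p.
Proof.
move=> p_pr n0 n_even.
have h0 : (0 < 2 * p.-1)%N by rewrite muln_gt0 -subn1 subn_gt0 prime_gt1.
by case: (cstar_kummer p n (2 * p.-1) p_pr n0 n_even h0 _ (dvdn_mull _ _)); rewrite ?oddM.
Qed.

(** * The regular parts c_n and the absorption of denominators *)

Definition pfac (p n : nat) : rat := p%:R ^+ n.-2.

Definition creg (p n : nat) : rat := beta n - eps p n / n%:R.

Lemma betaE p n : beta n = eps p n / n%:R + creg p n.
Proof. by rewrite /creg addrC subrK. Qed.

(** One factor [p] makes B_n p-integral; p^(n-2) is left against the denominator [n]. *)
Lemma pX_beta p n : (1 < n)%N -> p%:R ^+ n.-1 * beta n = pfac p n * (p%:R * bernoulli n) / n%:R.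
Proof. by case: n => [|[|n]] //= _; rewrite /beta /pfac /= exprSr; ring. Qed.

Lemma cregE p n : (1 < n)%N ->
  creg p n = cstar p n + pfac p n * (p%:R * bernoulli n) / n%:R.
Proof. by move=> n1; rewrite -pX_beta // /cstar /creg; ring. Qed.

(** It suffices that k < p^(k-1), which for k > 1 fails only at p = k = 2. *)
Lemma pfac_div p k n : prime p -> (1 < k)%N -> (k <= n)%N -> odd p || (3 < k)%N ->
  pfac p n / k%:R \in plocal p.
Proof.
move=> p_pr k1 le_kn good; apply: plocal_Xn_div => //; first exact: ltnW.
apply: (@leq_trans k.-2); last by lia.
have p1 := prime_gt1 p_pr; apply: logn_leq => //; first exact: ltnW.
have -> : k.-2.+1 = k.-1 by lia.
have [k3|k3] := leqP k 3; last first.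
  apply: leq_trans (_ : k < 2 ^ k.-1)%N _; last by rewrite leq_exp2r //; lia.
  case: k {k1 le_kn good} k3 => [|[|[|[|k]]]] // _; elim: k => // k IH.
  by rewrite /= expnS; move: IH => /=; lia.
have p3 : (2 < p)%N.
  by move: good; rewrite ltnNge k3 orbF => p_odd; rewrite odd_prime_gt2.
case: k k1 k3 {le_kn good} => [|[|[|[|k]]]] // _ _.
by rewrite /= expnS expn1; nia.
Qed.

Lemma creg_plocal p n : prime p -> (1 < n)%N -> ~~ odd n -> odd p || (3 < n)%N ->
  creg p n \in plocal p.
Proof.
move=> p_pr n1 n_even good; rewrite cregE // rpredD ?cstar_plocal ?(ltnW n1) //.
by rewrite mulrAC rpredM ?pfac_div ?plocal_pbernoulli.
Qed.

(* Leibniz's harmonic triangle: the reciprocals of [a * 'C(w, a)] with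
   [a <= w] are integer combinations of the reciprocals of [1, ..., w]. *)
Lemma plocal_Leibniz p e a w : prime p -> (0 < a)%N -> (a <= w)%N -> (w < p ^ e.+1)%N ->
  p%:R ^+ e / (a * 'C(w, a))%:R \in plocal p.
Proof.
move=> p_pr; elim: a w => // -[|a] IHa w _ le_aw lt_w.
  by rewrite mul1n bin1 plocal_Xn_div // logn_leq.
case: w le_aw lt_w => // w le_aw lt_w.
have -> : p%:R ^+ e / (a.+2 * 'C(w.+1, a.+2))%:R
    = p%:R ^+ e / (a.+1 * 'C(w, a.+1))%:R - p%:R ^+ e / (a.+1 * 'C(w.+1, a.+1))%:R :> rat.
  have E : (a.+2 * 'C(w.+1, a.+2) = w.+1 * 'C(w, a.+1))%N by rewrite -mul_bin_diag.
  have E' : (a.+1 * 'C(w.+1, a.+1) = w.+1 * 'C(w, a))%N by rewrite -mul_bin_diag.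
  have E2 : (a.+1 * 'C(w, a.+1) = (w - a) * 'C(w, a))%N by rewrite mul_bin_left.
  have c0 : ('C(w, a) > 0)%N by rewrite bin_gt0; lia.
  have c1 : ('C(w, a.+1) > 0)%N by rewrite bin_gt0; lia.
  have E3 : 'C(w, a.+1)%:R = (w - a)%N%:R * 'C(w, a)%:R / a.+1%:R :> rat.
    by rewrite -natrM -E2 natrM mulrAC mulfV ?mul1r // natr_neq0.
  rewrite E E' E2 !natrM E3.
  have d : w.+1%:R = (w - a)%N%:R + a.+1%:R :> rat by rewrite -natrD; congr _%:R; lia.
  rewrite d; have := natr_neq0 (R := rat) c0; have := natr_neq0 (R := rat) (ltn0Sn a).
  have : (w - a)%N%:R != 0 :> rat by rewrite natr_neq0; lia.
  have : (w - a)%N%:R + a.+1%:R != 0 :> rat by rewrite -d natr_neq0.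
  move: ((w - a)%N%:R : rat) (a.+1%:R : rat) ('C(w, a)%:R : rat) => x y z xy x0 y0 z0.
  by field; rewrite xy x0 y0 z0.
by rewrite rpredB ?IHa //; lia.
Qed.

(** C(w, a) C(N-1, w) = C(N-1, a) C(N-1-a, w-a), and a C(N-1, a) = (N - a) C(N-1, a-1). *)
Lemma dvd_bin N a w : (0 < a)%N -> (a <= w)%N ->
  (N - a %| a * 'C(w, a) * 'C(N.-1, w))%N.
Proof.
case: a => // a _ le_aw; case: N => [|N]; first by rewrite bin0n; case: w le_aw => // w; rewrite muln0.
have [le_wN|lt_Nw] := leqP w N; last by rewrite (bin_small lt_Nw) muln0.
have E : ('C(w, a.+1) * 'C(N, w) = 'C(N, a.+1) * 'C(N - a.+1, w - a.+1))%N.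
  apply/eqP; rewrite -(eqr_nat rat) !natrM !bin_factr ?leq_sub2r //; last by lia.
  have -> : (N - a.+1 - (w - a.+1) = N - w)%N by lia.
  by apply/eqP; field; rewrite !natr_fact_neq0.
by rewrite /= -mulnA E mulnA mul_bin_left subSS -mulnA dvdn_mulr.
Qed.

Lemma pfac_bin1 p k l w : prime p -> (0 < k)%N -> (0 < l)%N -> ~~ odd k -> ~~ odd l ->
    odd p || (3 < k)%N -> (k %/ 2 <= w)%N -> (w < k)%N ->
  'C((k + l) %/ 2 - 1, w)%:R * (pfac p k / l%:R) \in plocal p.
Proof.
move=> p_pr k0 l0 k_even l_even good le_w lt_w.
have [a def_k] : exists a, k = (2 * a)%N by exists k./2; lia.
have [b def_l] : exists b, l = (2 * b)%N by exists l./2; lia.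
have a0 : (0 < a)%N by lia.
have b0 : (0 < b)%N by lia.
have -> : ((k + l) %/ 2 - 1 = (a + b).-1)%N by lia.
have le_aw : (a <= w)%N by lia.
(* With N = m/2 and a = k/2, the divisor is l/2: the denominator [l] is traded for 2 a C(w, a),
   which is bounded in terms of [k] alone. *)
have /dvdnP[z def_z] := dvd_bin (a + b) a w a0 le_aw; rewrite addKn in def_z.
have L0 : (0 < a * 'C(w, a))%N by rewrite muln_gt0 a0 bin_gt0.
have -> : 'C((a + b).-1, w)%:R * (pfac p k / l%:R)
    = z%:R * (pfac p k / (2 * (a * 'C(w, a)))%:R).
  have : (a * 'C(w, a))%:R * 'C((a + b).-1, w)%:R = z%:R * b%:R :> rat by rewrite -!natrM def_z.
  rewrite def_l !(natrM _ 2); have := natr_neq0 (R := rat) b0; have := natr_neq0 (R := rat) L0.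
  move: ((a * 'C(w, a))%:R : rat) (b%:R : rat) (z%:R : rat) => x y t x0 y0 E.
  have -> : t = x * 'C((a + b).-1, w)%:R / y by rewrite E mulfK.
  by field; rewrite x0 y0.
apply: rpredM; first exact: nat_plocal.
have [p2|p_odd] := even_prime p_pr.
  have k3 : (3 < k)%N by rewrite p2 in good.
  (* The factor 2 costs one power of 2; what remains suffices since w < k <= 2^(k-2) for k >= 4. *)
  have -> : pfac p k / (2 * (a * 'C(w, a)))%:R = p%:R ^+ (k - 3) / (a * 'C(w, a))%:R.
    rewrite /pfac p2 (_ : k.-2 = (k - 3).+1); last by lia.
    by rewrite exprS (natrM _ 2) invfM mulrACA mulfV ?mul1r.
  apply: plocal_Leibniz => //; apply: leq_trans lt_w _; rewrite p2.
  have -> : ((k - 3).+1 = (k - 4).+2)%N by lia.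
  have -> : (k = (k - 4) + 4)%N by lia.
  rewrite addnK; elim: (k - 4)%N => // c IH.
  by rewrite expnS; lia.
have -> : pfac p k / (2 * (a * 'C(w, a)))%:R = p%:R ^+ k.-2 / (a * 'C(w, a))%:R / 2%:R.
  by rewrite natrM invfM [X in _ * X]mulrC mulrA.
rewrite plocal_div ?coprimen2 //; apply: plocal_Leibniz => //.
have -> : k.-2.+1 = k.-1 by lia.
by apply: leq_ltn_trans (ltn_expl _ (prime_gt1 p_pr)); lia.
Qed.

(** Since u + v = k - 1 with [k] even, one of [u] and [v] is at least k/2, and its binomial absorbs
    [l]. *)
Lemma pfac_bin p k l u v : prime p -> (0 < k)%N -> (0 < l)%N -> ~~ odd k -> ~~ odd l ->
    odd p || (3 < k)%N -> (u + v = k - 1)%N ->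
  'C((k + l) %/ 2 - 1, u)%:R * 'C((k + l) %/ 2 - 1, v)%:R * (pfac p k / l%:R) \in plocal p.
Proof.
move=> p_pr k0 l0 k_even l_even good def_uv.
have [le_u|lt_u] := leqP (k %/ 2) u.
  rewrite mulrAC; apply: rpredM; last exact: nat_plocal.
  by apply: pfac_bin1 => //; lia.
rewrite -mulrA; apply: rpredM; first exact: nat_plocal.
by apply: pfac_bin1 => //; lia.
Qed.

Lemma plocal_Mden p m : ~~ odd m -> (jden (m %/ 2))%:~R * beta m \in plocal p.
Proof.
move=> m_even; rewrite /jden (_ : (2 * (m %/ 2) = m)%N); last by lia.
by rewrite -/(beta m) mulrC -numqE int_plocal ?intr_int.
Qed.

Lemma cstar_diff p n h : prime p -> (0 < n)%N -> ~~ odd n -> (0 < h)%N -> ~~ odd h ->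
  (p.-1 %| h)%N -> (cstar p (n + h) - cstar p n) / h%:R \in plocal p.
Proof.
move=> p_pr n0 n_even h0 h_even dv.
have [_ H] := cstar_kummer p n h p_pr n0 n_even h0 h_even dv.
have k0 := natr_neq0 (R := rat) (kmod_gt0 p).
set x := _ - _ in H *.
have -> : x / h%:R = (kmod p)%:R * (x / (h%:R * (kmod p)%:R)).
  by field; rewrite k0 natr_neq0.
exact: rpredM (nat_plocal p _) H.
Qed.

(** Four cases, according to whether p - 1 divides [k] and [l]. [C] stands for the product of
    binomials; it serves to absorb the one dangerous quotient [pfac p k / l]. *)
Lemma plocal_main p (j C : rat) k l : prime p -> (1 < k)%N -> (k <= l)%N ->
    ~~ odd k -> ~~ odd l -> odd p || (3 < k)%N ->
    j \in plocal p -> j * beta (k + l) \in plocal p -> C \in plocal p ->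
    C * (pfac p k / l%:R) \in plocal p ->
  j * C * (beta (k + l) * (beta l + beta k) - beta l * beta k) \in plocal p.
Proof.
move=> p_pr k1 le_kl k_even l_even good jI jbI CI CpI.
have k0 := ltnW k1; have l0 := leq_trans k0 le_kl; have l1 := leq_trans k1 le_kl.
set m := (k + l)%N in jbI *; have m1 : (1 < m)%N by lia.
have m_even : ~~ odd m by rewrite oddD negb_add (negPf k_even) (negPf l_even).
have good' n : (k <= n)%N -> odd p || (3 < n)%N.
  by move=> le_kn; case/orP: good => [->//|k3]; rewrite (leq_trans k3) ?orbT.
have cI n : (k <= n)%N -> ~~ odd n -> creg p n \in plocal p.
  by move=> le_kn n_even; apply: creg_plocal => //; [apply: leq_trans le_kn | apply: good'].
have ck := cI k (leqnn k) k_even; have cl := cI l le_kl l_even.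
have cm := cI m (leq_addr _ _) m_even.
have bI n := plocal_pbernoulli p n p_pr.
have qI a n : (k <= a)%N -> (a <= n)%N -> pfac p n / a%:R \in plocal p.
  by move=> le_ka le_an; apply: pfac_div => //; [apply: leq_trans le_ka | apply: good'].
have nb n : ~~ (p.-1 %| n)%N -> beta n = creg p n.
  by move=> /negPf nd; rewrite (betaE p) /eps nd mul0r add0r.
have sE n : (1 < n)%N -> cstar p n = creg p n - pfac p n * (p%:R * bernoulli n) / n%:R.
  by move=> n1; rewrite cregE // addrK.
have Bn n : (0 < n)%N -> bernoulli n = n%:R * beta n.
  by move=> n0; rewrite /beta mulrC divfK // natr_neq0.
have k0' := natr_neq0 (R := rat) k0; have l0' := natr_neq0 (R := rat) l0.
have m0 := ltnW m1; have m0' := natr_neq0 (R := rat) m0.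
have p0' := natr_neq0 (R := rat) (prime_gt0 p_pr).
have mE : m%:R = k%:R + l%:R :> rat by rewrite natrD.
(* For p = 2 or 3, p - 1 divides every even number; so in the mixed cases [kmod p] is [p]. *)
have p5P h : ~~ odd h -> ~~ (p.-1 %| h)%N -> (4 < p)%N.
  move=> h_even; apply: contraR; rewrite -leqNgt => p4.
  have p23 q : prime q -> (q <= 4)%N -> (q == 2%N) || (q == 3%N) by case: q => [|[|[|[|[|q]]]]].
  by have /orP[/eqP-> | /eqP->] := p23 p p_pr p4; rewrite ?dvd1n // dvdn2.
have qkl := qI k l (leqnn k) le_kl; have qll := qI l l le_kl (leqnn l).
have qkk := qI k k (leqnn k) (leqnn k).
have qkm := qI k m (leqnn k) (leq_addr _ _); have qlm := qI l m le_kl (leq_addl _ _).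
have [dk|ndk] := boolP (p.-1 %| k)%N; have [dl|ndl] := boolP (p.-1 %| l)%N.
- have dm : (p.-1 %| m)%N by rewrite dvdn_add.
  have eE n : (p.-1 %| n)%N -> eps p n = eps p m by rewrite /eps dm => ->.
  have := betaE p k; have := betaE p l; have := betaE p m; rewrite (eE k) // (eE l) //.
  have := cstar_diff p k l p_pr k0 k_even l0 l_even dl.
  have := cstar_diff p l k p_pr l0 l_even k0 k_even dk.
  rewrite (addnC l k) -/m => Y X Em El Ek.
  pose J := j * (eps p m / m%:R).
  have JI : J \in plocal p.
    have -> : J = j * beta m - j * creg p m by rewrite Em /J; ring.
    by apply: rpredB jbI (rpredM jI cm).
  pose x := (cstar p m - cstar p k) / l%:R; pose y := (cstar p m - cstar p l) / k%:R.
  (* The terms quadratic in e cancel because 1/k + 1/l = m/(kl). The linear ones are J times c_l +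
     c_k + m ((c_m - c_k)/l + (c_m - c_l)/k), where the differences are then expressed through
     c*_n. *)
  have -> : j * C * (beta m * (beta l + beta k) - beta l * beta k)
    = C * (J * (creg p l + creg p k) + j * (creg p m * (creg p l + creg p k) - creg p l * creg p k))
    + J * (C * (m%:R * (x + y))
           + C * (pfac p m / l%:R + pfac p m / k%:R) * (p%:R * bernoulli m)
           - (C * (pfac p k / k%:R) + C * (pfac p k / l%:R)) * (p%:R * bernoulli k)
           - C * (pfac p l / k%:R + pfac p l / l%:R) * (p%:R * bernoulli l)).
    rewrite Em El Ek /x /y /J !sE // mE; rewrite mE in m0'.
    move: (creg p k) (creg p l) (creg p m) (pfac p k) (pfac p l) (pfac p m) (eps p m).
    move: (p%:R * _) (p%:R * _) (p%:R * _) k0' l0' m0'.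
    move: (k%:R : rat) (l%:R : rat) => K L bk bl bm K0 L0 KL0 ? ? ? ? ? ? ?.
    by field; rewrite K0 L0 KL0.
  apply: rpredD.
    apply: rpredM CI (rpredD (rpredM JI (rpredD cl ck)) _).
    by apply: rpredM jI (rpredB (rpredM cm (rpredD cl ck)) (rpredM cl ck)).
  apply: rpredM JI (rpredB (rpredB (rpredD _ _) _) _).
  + by apply: rpredM CI (rpredM (nat_plocal _ _) (rpredD X Y)).
  + by apply: rpredM (rpredM CI (rpredD qlm qkm)) (bI m).
  + by apply: rpredM (rpredD (rpredM CI qkk) CpI) (bI k).
  + by apply: rpredM (rpredM CI (rpredD qkl qll)) (bI l).
(* Here the expression is b_k (b_m - b_l) + b_m b_l with only b_k non-integral. Writing b_k as p B_k
   / (p k), one needs the congruence modulo k p, with its additional factor [p]. *)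
- have ndm : ~~ (p.-1 %| m)%N by rewrite dvdn_addr.
  have [_] := cstar_kummer p l k p_pr l0 l_even k0 k_even dk.
  rewrite /kmod ltnNge (p5P l) //= (addnC l k) -/m.
  set x := _ / _ => X; have bl := nb l ndl; have bm := nb m ndm.
  rewrite -bl in cl; rewrite -bm in cm.
  have -> : j * C * (beta m * (beta l + beta k) - beta l * beta k)
    = j * (C * ((p%:R * bernoulli k) * (x + pfac p m / k%:R * beta m - pfac p l / k%:R * beta l)
           + beta m * beta l)).
    rewrite /x (sE l) // (sE m) // -bl -bm !Bn //; move: k0' l0' m0' p0'.
    move: (beta k) (beta l) (beta m) (pfac p l) (pfac p m) => b1 b2 b3 q2 q3.
    move: (k%:R : rat) (l%:R : rat) (m%:R : rat) (p%:R : rat) => K L M P K0 L0 M0 P0.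
    by field; rewrite K0 L0 M0 P0.
  apply: rpredM jI (rpredM CI (rpredD (rpredM (bI k) _) (rpredM cm cl))).
  by apply: rpredB (rpredD X (rpredM qkm cm)) (rpredM qkl cl).
(* The roles of [k] and [l] are exchanged; the correction to c*_k is now divided by [l], so [C] is
   used. *)
- have ndm : ~~ (p.-1 %| m)%N by rewrite dvdn_addl.
  have [_] := cstar_kummer p k l p_pr k0 k_even l0 l_even dl.
  rewrite /kmod ltnNge (p5P k) //= -/m.
  set x := _ / _ => X; have bk := nb k ndk; have bm := nb m ndm.
  rewrite -bk in ck; rewrite -bm in cm.
  have -> : j * C * (beta m * (beta l + beta k) - beta l * beta k)
    = j * ((p%:R * bernoulli l) * (C * (x + pfac p m / l%:R * beta m) - C * (pfac p k / l%:R) * beta k)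
           + C * (beta m * beta k)).
    rewrite /x (sE k) // (sE m) // -bk -bm !Bn //; move: k0' l0' m0' p0'.
    move: (beta k) (beta l) (beta m) (pfac p k) (pfac p m) => b1 b2 b3 q2 q3.
    move: (k%:R : rat) (l%:R : rat) (m%:R : rat) (p%:R : rat) => K L M P K0 L0 M0 P0.
    by field; rewrite K0 L0 M0 P0.
  apply: rpredM jI (rpredD (rpredM (bI l) _) (rpredM CI (rpredM cm ck))).
  by apply: rpredB (rpredM CI (rpredD X (rpredM qlm cm))) (rpredM CpI ck).
(* Now b_k and b_l are p-integral, and [j] clears the denominator of b_m. *)
have -> : j * C * (beta m * (beta l + beta k) - beta l * beta k)
    = C * ((j * beta m) * (beta l + beta k) - j * (beta l * beta k)) by ring.
rewrite (nb k) // (nb l) //; apply: rpredM CI (rpredB (rpredM jbI (rpredD cl ck)) _).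
exact: rpredM jI (rpredM cl ck).
Qed.

Lemma half_notin_plocal : 2^-1 \notin plocal 2.
Proof. by []. Qed.

(** Here b_2 = 1/12 = 1/4 - 1/6, so c_2 = -1/6 is not 2-integral. With J = j / (2m), the only term
    that fails to be 2-integral is J/6; since J is odd at 2, adding 1/2 repairs it. *)
Lemma plocal_main_two (j : rat) m : ~~ odd m -> (6 <= m)%N -> j = (denq (beta m))%:~R ->
  j * (m - 2)%N%:R / 2 * (beta m * (beta (m - 2) + beta 2) - beta (m - 2) * beta 2) + 1 / 2
    \in plocal 2.
Proof.
move=> m_even m6 def_j; set l := (m - 2)%N.
have l_even : ~~ odd l by rewrite /l oddB; lia.
have [a def_m] : exists a, m = (2 * a)%N by exists m./2; lia.
have m0 : m%:R != 0 :> rat by rewrite natr_neq0; lia.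
have l0 : l%:R != 0 :> rat by rewrite natr_neq0; rewrite /l; lia.
have cm : creg 2 m \in plocal 2 by apply: creg_plocal => //; lia.
have cl : creg 2 l \in plocal 2 by apply: creg_plocal => //; rewrite /l; lia.
have eE n : eps 2 n = 2^-1 by rewrite /eps dvd1n; field.
have Em := betaE 2 m; have El := betaE 2 l; rewrite !eE in Em El.
have jI : j \in plocal 2 by rewrite def_j int_plocal ?intr_int.
pose J := j / 2 / m%:R.
have jbE : j * beta m = (numq (beta m))%:~R by rewrite def_j mulrC -numqE.
have JE : J = j * beta m - j * creg 2 m by rewrite Em /J; ring.
have JI : J \in plocal 2.
  by rewrite JE jbE; apply: rpredB (rpredM jI cm); rewrite int_plocal ?intr_int.
(* b_m differs from 1/(2m) by the 2-integral c_m, so its reduced denominator is even. *)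
have num_odd : odd `|numq (beta m)|%N.
  have : ~~ coprime 2 `|denq (beta m)|%N.
    apply: contra half_notin_plocal => bI.
    have -> : 2^-1 = m%:R * (beta m - creg 2 m) by rewrite Em addrK mulrC divfK.
    by rewrite rpredM ?nat_plocal // rpredB.
  rewrite coprime2n => den_even; have := coprime_num_den (beta m).
  apply: contraLR => num_even; apply/eqP => g1.
  by have := dvdn_gcd 2 `|numq (beta m)| `|denq (beta m)|; rewrite g1 !dvdn2 num_even den_even.
have mE : m%:R = 2 * a%:R :> rat by rewrite def_m natrM.
have lE : l%:R = 2 * (a - 1)%N%:R :> rat by rewrite /l -natrM; congr _%:R; lia.
have aE : (a - 1)%N%:R = a%:R - 1 :> rat by rewrite natrB //; lia.
have a0 : a%:R != 0 :> rat by rewrite natr_neq0 //; lia.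
have a1 : a%:R - 1 != 0 :> rat by rewrite -aE natr_neq0 //; lia.
have halfJ : (J - 1) / 2 \in plocal 2.
  have -> : (J - 1) / 2 = ((numq (beta m))%:~R - 1) / 2 - J * (m%:R * creg 2 m).
    by rewrite -jbE Em /J mE; field; rewrite a0.
  apply: rpredB; last by apply: rpredM JI (rpredM (nat_plocal _ _) cm).
  have [w ->] : exists w : int, numq (beta m) = 2 * w + 1.
    by exists ((numq (beta m) - 1) %/ 2)%Z; lia.
  by rewrite intrD intrM addrK mulrC mulKf // int_plocal ?intr_int.
(* The first summand is J/6 + 1/2 rewritten through (J - 1)/2; in the rest only the odd denominator
   3 occurs. *)
have -> : j * l%:R / 2 * (beta m * (beta l + beta 2) - beta l * beta 2) + 1 / 2
    = ((J - 1) / 2 + 2%:R) / 3%:R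
      + J * ((a - 1)%N%:R * creg 2 l + a%:R * creg 2 m
             + (4 * a * (a - 1))%N%:R * (creg 2 m * creg 2 l)
             + (a * (a - 1))%N%:R * (creg 2 m - creg 2 l) / 3%:R).
  have -> : beta 2 = 1 / 12 by rewrite /beta bernoulli2; field.
  rewrite /J !natrM aE Em El mE lE aE.
  by field; rewrite a0 a1.
apply: rpredD.
  by apply: plocal_div => //; apply: rpredD halfJ (nat_plocal 2 2).
apply: rpredM JI (rpredD (rpredD (rpredD _ _) _) _).
- exact: rpredM (nat_plocal _ _) cl.
- exact: rpredM (nat_plocal _ _) cm.
- exact: rpredM (nat_plocal _ _) (rpredM cm cl).
- by apply: plocal_div => //; apply: rpredM (nat_plocal _ _) (rpredB cm cl).
Qed.

(** * Integrality at all primes together *)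

Theorem theorem5p1 (k l m u v : nat) (k_gt0 : (0 < k)%N) (l_gt0 : (0 < l)%N)
    (k_even : ~~ odd k) (l_even : ~~ odd l) (le_kl : (k <= l)%N)
    (def_m : m = (k + l)%N) (m_ge6 : (6 <= m)%N) (def_uv : (u + v = k - 1)%N) :
  (jden (m %/ 2))%:~R * ('C(m %/ 2 - 1, u))%:R * ('C(m %/ 2 - 1, v))%:R
    * (bernoulli m / m%:R * (bernoulli l / l%:R + bernoulli k / k%:R)
       - bernoulli l / l%:R * (bernoulli k / k%:R))
    + (k == 2%N)%:R / 2 \is a Num.int.
Proof.
rewrite -!/(beta _); apply: rat_int_plocal => p p_pr.
have m_even : ~~ odd m by rewrite def_m oddD negb_add (negPf k_even) (negPf l_even).
have [good|] := boolP (odd p || (3 < k)%N).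
  (* If k = 2 in this case then [p] is odd, so the added 1/2 is p-integral. *)
  apply: rpredD; last first.
    case: eqP => [k2|_]; last by rewrite mul0r rpred0.
    by rewrite plocal_div ?rpred1 // coprimen2; move: good; rewrite k2 orbF.
  rewrite -(mulrA _%:~R) def_m; apply: plocal_main => //; first by lia.
  - by rewrite int_plocal ?intr_int.
  - by apply: plocal_Mden; rewrite -def_m.
  - by rewrite rpredM ?nat_plocal.
  - exact: pfac_bin.
rewrite negb_or -leqNgt => /andP[p_even k3].
have k2 : k = 2%N by lia.
have p2 : p = 2%N by have [//|p_odd] := even_prime p_pr; rewrite p_odd in p_even.
have l2 : l = (m - 2)%N by lia.
(* For k = 2 one of [u] and [v] is 0 and the other 1, so the binomials multiply to m/2 - 1. *)
have CE : 'C(m %/ 2 - 1, u)%:R * 'C(m %/ 2 - 1, v)%:R = (m - 2)%N%:R / 2 :> rat.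
  have -> : (m - 2 = (m %/ 2 - 1) * 2)%N by lia.
  rewrite natrM mulfK // -natrM.
  have : (u = 0 /\ v = 1)%N \/ (u = 1 /\ v = 0)%N by lia.
  by case=> -[-> ->]; rewrite bin0 bin1 ?muln1 ?mul1n.
rewrite -(mulrA _%:~R) CE mulrA p2 k2 l2; apply: plocal_main_two => //.
by rewrite /jden (_ : (2 * (m %/ 2) = m)%N) //; lia.
Qed.
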